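(* Let $G$ be a finite group and let $k$ be the height of $L(G)$. Then $\omega(\mathcal I(G))=k-1=\chi(\mathcal I(G))$.
   Context: For a finite group $G$, the inclusion graph of subgroups $\mathcal I(G)$ is the simple graph whose vertices are the proper subgroups of $G$, where ''proper'' means different from both the trivial subgroup and $G$ itself; two distinct vertices $H,K$ are adjacent if and only if $H\subset K$ or $K\subset H$. Graphs are understood to have a nonempty vertex set, so $G$ is assumed to have at least one subgroup different from $\{e\}$ and $G$. $L(G)$ is the subgroup lattice of $G$ (all subgroups, including $\{e\}$ and $G$), and its height is the length (number of strict inclusions) of a longest chain of subgroups from $G$ to $\{e\}$. $\omega$ is the clique number and $\chi$ the chromatic number of a graph. *)

(* Defs.v *)
From HB Require Import structures.
From mathcomp Require Import all_boot all_order all_fingroup.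

Set Implicit Arguments.
Unset Strict Implicit.
Unset Printing Implicit Defensive.

Record sgraph := SGraph {
  vertex :> finType;
  adj : rel vertex;
  adj_sym : symmetric adj;
  adj_irrefl : irreflexive adj
}.

Definition is_clique (X : sgraph) (A : {set X}) : bool :=
  [forall x in A, forall y in A, (x != y) ==> adj x y].

Definition clique_number (X : sgraph) : nat :=
  \max_(A : {set X} | is_clique A) #|A|.

Definition proper_coloring (X : sgraph) (n : nat) (c : {ffun X -> 'I_n}) : bool :=
  [forall x, forall y, adj x y ==> (c x != c y)].

Definition colorable (X : sgraph) (n : nat) : bool :=
  [exists c : {ffun X -> 'I_n}, proper_coloring c].

Lemma colorable_ex (X : sgraph) : exists n, colorable X n.
Proof.
exists #|X|; apply/existsP; exists [ffun x => enum_rank x].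
apply/forallP=> x; apply/forallP=> y; apply/implyP=> xy.
rewrite !ffunE; apply/eqP=> /enum_rank_inj exy.
by rewrite exy adj_irrefl in xy.
Qed.

Definition chromatic_number (X : sgraph) : nat := ex_minn (colorable_ex X).

Definition proper_subgroup (gT : finGroupType) (G H : {group gT}) : bool :=
  [&& H \subset G, H != 1%G & H != G].

Definition inclusion_adj (gT : finGroupType) (G : {group gT}) :
    rel {H : {group gT} | proper_subgroup G H} :=
  fun H K =>
    (H != K) && ((val H \subset val K) || (val K \subset val H)).

Lemma inclusion_adj_sym (gT : finGroupType) (G : {group gT}) :
  symmetric (@inclusion_adj gT G).
Proof. by move=> H K; rewrite /inclusion_adj eq_sym orbC. Qed.

Lemma inclusion_adj_irrefl (gT : finGroupType) (G : {group gT}) :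
  irreflexive (@inclusion_adj gT G).
Proof. by move=> H; rewrite /inclusion_adj eqxx. Qed.

Definition inclusion_graph (gT : finGroupType) (G : {group gT}) : sgraph :=
  SGraph (@inclusion_adj_sym gT G) (@inclusion_adj_irrefl gT G).

(* The chain is G :: s, so that size s counts its strict inclusions. *)
Definition subgroup_chain (gT : finGroupType) (G : {group gT})
    (s : seq {group gT}) : bool :=
  path (fun H K : {group gT} => K \proper H) G s && (last G s == 1%G).

Definition has_chain (gT : finGroupType) (G : {group gT}) (n : nat) : bool :=
  [exists s : n.-tuple {group gT}, subgroup_chain G s].

Lemma has_chain_ex (gT : finGroupType) (G : {group gT}) :
  exists n, has_chain G n.
Proof.
have [G1 | ntG] := eqVneq G 1%G.
  by exists 0; apply/existsP; exists [tuple]; rewrite /subgroup_chain /= G1.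
exists 1; apply/existsP; exists [tuple 1%G].
by rewrite /subgroup_chain /= eqxx !andbT proper1G.
Qed.

Lemma has_chain_bound (gT : finGroupType) (G : {group gT}) (n : nat) :
  has_chain G n -> n <= #|G|.
Proof.
case/existsP=> s /andP[ps _]; rewrite -(size_tuple s).
elim: {s}(tval s) G ps => //= H s IHs G /andP[/proper_card HG /IHs le_sH].
exact: leq_ltn_trans le_sH HG.
Qed.

Definition subgroup_lattice_height (gT : finGroupType) (G : {group gT}) : nat :=
  ex_maxn (has_chain_ex G) (@has_chain_bound gT G).

(* Main.v *)
Require Import Defs.
From mathcomp Require Import all_boot all_order all_fingroup.

Set Implicit Arguments.
Unset Strict Implicit.
Unset Printing Implicit Defensive.

(** Three inequalities close up: k - 1 <= omega <= chi <= k - 1.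

    A longest chain from [G] down to the trivial group, with its two ends
    removed, has k - 1 members; they are proper subgroups and pairwise
    comparable, hence a clique ([height_le_clique_number]).  A proper coloring is
    injective on a clique, so omega <= chi in every graph
    ([clique_number_le_colors]).  Finally, color each vertex [H] by the height of
    its own subgroup lattice.  Height is strictly increasing along strict
    inclusion, since a chain for [H] extends upwards by any larger group
    ([height_proper]); so adjacent vertices receive different colors, and the
    colors lie strictly between 0, the height of the trivial group, and k, the
    height of [G].  That leaves k - 1 colors ([height_colorable]). *)

(** A proper coloring is injective on a clique. *)
Lemma clique_card_le_colors (X : sgraph) (n : nat) (A : {set X}) :
  colorable X n -> is_clique A -> #|A| <= n.
Proof.
case/existsP=> c /forallP c_proper /forall_inP cliqueA.
have c_inj : {in A &, injective c}.
  move=> x y Ax Ay; apply: contra_eq => neq_xy.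
  have /forall_inP/(_ y Ay) := cliqueA x Ax.
  rewrite neq_xy /= => xy.
  by have /forallP/(_ y)/implyP/(_ xy) := c_proper x.
by rewrite -(card_in_imset c_inj) -[n in _ <= n]card_ord max_card.
Qed.

Lemma clique_number_le_colors (X : sgraph) (n : nat) :
  colorable X n -> clique_number X <= n.
Proof. by move=> col_n; apply/bigmax_leqP=> A; apply: clique_card_le_colors. Qed.

Lemma chromatic_number_colorable (X : sgraph) : colorable X (chromatic_number X).
Proof. by rewrite /chromatic_number; case: ex_minnP. Qed.

Lemma chromatic_number_le (X : sgraph) (n : nat) :
  colorable X n -> chromatic_number X <= n.
Proof. by rewrite /chromatic_number; case: ex_minnP => m _ min_m /min_m. Qed.

Section Height.

Variable gT : finGroupType.
Implicit Types (G H K : {group gT}) (s : seq {group gT}).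

Let gproper := fun H K : {group gT} => K \proper H.

Lemma gproper_trans : transitive gproper.
Proof. by move=> H G K HG KH; apply: proper_trans KH HG. Qed.

Lemma gproper_irr : irreflexive gproper.
Proof. by move=> H; rewrite /gproper properxx. Qed.

Lemma subgroup_chain_size_le_height G s :
  subgroup_chain G s -> size s <= subgroup_lattice_height G.
Proof.
rewrite /subgroup_lattice_height; case: ex_maxnP => m _ max_m chain_s.
by apply: max_m; apply/existsP; exists (in_tuple s).
Qed.

Lemma longest_subgroup_chain G :
  exists2 s, subgroup_chain G s & size s = subgroup_lattice_height G.
Proof.
rewrite /subgroup_lattice_height; case: ex_maxnP => m /existsP[s chain_s] _.
by exists s; rewrite ?size_tuple.
Qed.

(** A longest chain for [H] becomes a chain for [K], longer by one, once [H] is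
    put in front of it. *)
Lemma height_proper H K :
  H \proper K ->
  subgroup_lattice_height H < subgroup_lattice_height K.
Proof.
move=> HK; have [s /andP[path_s last_s] <-] := longest_subgroup_chain H.
apply: (@subgroup_chain_size_le_height K (H :: s)).
by rewrite /subgroup_chain /= HK path_s.
Qed.

Lemma height_gt0 H : H != 1%G -> 0 < subgroup_lattice_height H.
Proof.
move=> ntH; apply: leq_ltn_trans (leq0n _) (@height_proper 1%G H _).
by rewrite proper1G.
Qed.

Lemma proper_subgroup_proper G H : proper_subgroup G H -> H \proper G.
Proof. by case/and3P=> sHG _ neqHG; rewrite properEneq neqHG. Qed.

(** Adjacent vertices are strictly nested, so their heights differ: height is a
    proper coloring. *)
Lemma height_colorable G :
  colorable (inclusion_graph G) (subgroup_lattice_height G - 1).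
Proof.
pose ht := @subgroup_lattice_height gT.
have ht_vertex (x : inclusion_graph G) : 0 < ht (val x) < ht G.
  have prx := valP x; rewrite (height_proper (proper_subgroup_proper prx)).
  by case/and3P: prx => _ ntx _; rewrite height_gt0.
(* The heights 1, ..., k - 1 are shifted down to the colors 0, ..., k - 2. *)
have color_lt (x : inclusion_graph G) : ht (val x) - 1 < ht G - 1.
  by case/andP: (ht_vertex x) => x_gt0 x_lt; rewrite ltn_sub2r // (leq_ltn_trans x_gt0).
apply/existsP; exists [ffun x => Ordinal (color_lt x)].
apply/forallP=> x; apply/forallP=> y; apply/implyP=> /andP[neq_xy cmp_xy].
rewrite !ffunE -val_eqE /=.
have [/andP[x_gt0 _] /andP[y_gt0 _]] := (ht_vertex x, ht_vertex y).
rewrite -(eqn_add2r 1) !subnK // neq_ltn.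
case/orP: cmp_xy => sub_xy; apply/orP; [left | right];
  by apply: height_proper; rewrite properEneq sub_xy andbT // eq_sym.
Qed.

Lemma sorted_comparable s H K :
  sorted gproper s -> H \in s -> K \in s -> (H \subset K) || (K \subset H).
Proof.
move=> sorted_s Hs Ks.
have lt_nth := sorted_ltn_nth gproper_trans 1%G sorted_s.
rewrite -(nth_index 1%G Hs) -(nth_index 1%G Ks).
case: (ltngtP (index H s) (index K s)) => [ltHK | ltKH | ->].
- by rewrite orbC (proper_sub (lt_nth _ _ _ _ ltHK)) // inE index_mem.
- by rewrite (proper_sub (lt_nth _ _ _ _ ltKH)) // inE index_mem.
- by rewrite subxx.
Qed.

(** The clique consists of the interior members of a longest chain.  Without
    [G != 1] the two ends of the chain could coincide. *)
Lemma height_le_clique_number G :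
  G != 1%G ->
  subgroup_lattice_height G - 1 <= clique_number (inclusion_graph G).
Proof.
move=> ntG; have [s /andP[path_s /eqP last_s] <-] := longest_subgroup_chain G.
case/lastP: s path_s last_s => [_ G1 | s K]; first by rewrite -G1 eqxx in ntG.
rewrite last_rcons size_rcons subn1 /= => path_s K1; subst K.
have sorted_G : sorted gproper (G :: rcons s 1%G) by [].
have uniq_G := sorted_uniq gproper_trans gproper_irr sorted_G.
(* No repetition in the whole chain: the interior avoids the trivial group
   and has as many members as entries. *)
have /andP[_ /andP[not1_s uniq_s]] :
    [&& G \notin rcons s 1%G, 1%G \notin s & uniq s].
  by move: uniq_G; rewrite cons_uniq rcons_uniq.
have sorted_s : sorted gproper s.
  by move: path_s; rewrite rcons_path => /andP[/path_sorted].
have s_proper H : H \in s -> proper_subgroup G H.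
  move=> Hs; have /allP/(_ H) := order_path_min gproper_trans path_s.
  rewrite mem_rcons inE Hs orbT => /(_ isT) HG.
  rewrite /proper_subgroup (proper_sub HG) /=; apply/andP; split.
    by apply: contraNneq not1_s => <-.
  by apply: contraTneq HG => ->; rewrite /gproper properxx.
pose A : {set inclusion_graph G} := [set x | val x \in s].
have cliqueA : is_clique A.
  apply/forall_inP=> x; rewrite inE => xs; apply/forall_inP=> y; rewrite inE => ys.
  by apply/implyP=> neq_xy; apply/andP; split; last exact: (sorted_comparable sorted_s).
have cardA : #|A| = size s.
  rewrite -(card_uniqP uniq_s) -(card_imset _ val_inj); apply: eq_card => H.
  apply/imsetP/idP => [[x + ->] | Hs]; first by rewrite inE.
  by exists (Sub H (s_proper H Hs)); rewrite ?inE SubK.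
by rewrite -cardA; apply: (leq_bigmax_cond (P := @is_clique _) A).
Qed.

End Height.

Theorem corollary2p1 (gT : finGroupType) (G : {group gT}) (k : nat)
    (hG : exists H : {group gT}, proper_subgroup G H)
    (hk : k = subgroup_lattice_height G) :
  clique_number (inclusion_graph G) = k - 1 /\
  k - 1 = chromatic_number (inclusion_graph G).
Proof.
(* Any vertex is a nontrivial subgroup of [G]. *)
have ntG : G != 1%G.
  case: hG => H /and3P[sHG ntH _]; apply: contraNneq ntH => G1.
  by rewrite -val_eqE /= -subG1 -[1%g]/(gval 1%G) -G1.
have clique_ge := height_le_clique_number ntG.
have clique_le := clique_number_le_colors (chromatic_number_colorable (inclusion_graph G)).
have chrom_le := chromatic_number_le (height_colorable G).
rewrite hk; split; apply/eqP; rewrite eqn_leq ?clique_ge ?chrom_le ?andbT.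
  exact: leq_trans clique_le chrom_le.
exact: leq_trans clique_ge clique_le.
Qed.
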